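(* Let $Q=\{(m,n)\in\mathbb{Z}^2\mid m\le n-2\}$, whose elements are viewed as arcs connecting non-neighbouring integers. Let $\mathfrak{T}\subseteq Q$ be a locally finite maximal collection of non-crossing arcs. Then there is an $\mathrm{SL}_2$-tiling $r:Q\to\{1,2,3,\ldots\}$ which satisfies $r(\mathfrak{t})=1$ for each $\mathfrak{t}\in\mathfrak{T}$.
   Context: Two arcs $(m,n),(p,q)\in Q$ cross if $m<p<n<q$ or $p<m<q<n$. A maximal collection of non-crossing arcs is a set of pairwise non-crossing arcs which is maximal under inclusion among such sets. It is locally finite if for each integer $n$ it contains only finitely many arcs of the form $(m,n)$ and $(n,p)$. An $\mathrm{SL}_2$-tiling of the half plane $Q$ with values in a commutative ring $R$ is a map $r:Q\to R$ such that $$r(i,j)\,r(i+1,j+1)-r(i,j+1)\,r(i+1,j)=1$$ whenever all four pairs lie in $Q$ (i.e. $i\le j-3$), and such that $$r(i,i+2)\,r(i+1,i+3)-r(i,i+3)=1$$ for each $i\in\mathbb{Z}$. In the claim, the values are positive integers (with $R=\mathbb{Z}$). *)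

(* Defs.v *)
From HB Require Import structures.
From mathcomp Require Import all_boot all_order all_algebra.
From mathcomp Require Import boolp classical_sets functions cardinality.

Set Implicit Arguments.
Unset Strict Implicit.
Unset Printing Implicit Defensive.

Import Order.TTheory GRing.Theory Num.Theory.

Local Open Scope classical_set_scope.
Local Open Scope ring_scope.

Definition Qarc := {a : int * int | a.1 <= a.2 - 2}.

Definition src (a : Qarc) : int := (val a).1.
Definition tgt (a : Qarc) : int := (val a).2.

Definition crosses (a b : Qarc) : bool :=
  [|| [&& src a < src b, src b < tgt a & tgt a < tgt b]
    | [&& src b < src a, src a < tgt b & tgt b < tgt a]].

Definition non_crossing (T : set Qarc) : Prop :=
  forall a b, T a -> T b -> ~~ crosses a b.

Definition maximal_non_crossing (T : set Qarc) : Prop :=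
  non_crossing T /\ forall S : set Qarc, non_crossing S -> T `<=` S -> S = T.

Definition locally_finite (T : set Qarc) : Prop :=
  forall n : int, finite_set [set a | T a /\ tgt a = n]
               /\ finite_set [set a | T a /\ src a = n].

(* The arcs are quantified over and identified by their endpoints, so that each
   relation is required exactly when all the pairs it involves are arcs. *)
Definition SL2_tiling (R : comPzRingType) (r : Qarc -> R) : Prop :=
  (forall (i j : int) (a b c d : Qarc),
     val a = (i, j) -> val b = (i + 1, j + 1) ->
     val c = (i, j + 1) -> val d = (i + 1, j) ->
     r a * r b - r c * r d = 1)
  /\
  (forall (i : int) (a b c : Qarc),
     val a = (i, i + 2) -> val b = (i + 1, i + 3) -> val c = (i, i + 3) ->
     r a * r b - r c = 1).

(* Main.v *)
(** Let [E m n] say that [(m, n)] belongs to [T] or that [n = m + 1], and let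
    [a k] be the number of triangles of the triangulation [T] at the vertex [k],
    which is finite by local finiteness. The two-sided recurrence
    [v (k + 1) + v (k - 1) = a k * v k] has a solution in Z^2 with
    [det (v 0, v 1) = 1], and [r (i, j) = det (v i, v j)] is an SL2-tiling by the
    Pluecker relation. Gluing the two parts of the triangulation below an arc
    along its triangle [(m, k, n)] shows by induction that [v k = v m + v n],
    hence [r = 1] on [T]; expanding across [k] then gives positivity below each
    arc of [T]. Finally every interval lies below an arc of [T], as otherwise some
    vertex would have infinitely many arcs. *)
Require Import Defs.
From mathcomp Require Import all_boot all_order all_algebra.
From mathcomp Require Import boolp classical_sets functions cardinality.
From mathcomp Require Import zify ring lra.

Set Implicit Arguments.
Unset Strict Implicit.

Import Order.TTheory GRing.Theory Num.Theory.

Local Open Scope classical_set_scope.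
Local Open Scope ring_scope.

(** * Counting and maximum lemmas *)

Lemma sum_bool_last (f : nat -> bool) (d N : nat) :
  (d < N)%N -> f d -> (forall e, (d < e < N)%N -> ~~ f e) ->
  (\sum_(0 <= e < N) f e = \sum_(0 <= e < d) f e + 1)%N.
Proof.
move=> dN fd fF; rewrite (@big_cat_nat _ _ _ d) //=; last exact: ltnW.
congr (_ + _)%N; rewrite big_ltn // fd big_nat big1 ?addn0 // => e eN.
by rewrite (negbTE (fF _ eN)).
Qed.

Lemma max_int_le (P : int -> bool) (i0 b : int) :
  P i0 -> (forall i, P i -> i <= b) ->
  exists2 i, P i & forall j, P j -> j <= i.
Proof.
move=> Pi0 Pb.
pose Q d := P (i0 + d%:Z).
have exQ : exists d, Q d by exists 0%N; rewrite /Q addr0.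
have Qb d : Q d -> (d <= `|b - i0|)%N by move/Pb; lia.
case: (ex_maxnP exQ Qb) => d Qd dmax; exists (i0 + d%:Z) => // j Pj.
case: (lerP j i0) => [|ji0]; first lia.
have := dmax `|j - i0|%N; rewrite /Q (_ : i0 + _ = j); last lia.
by move/(_ Pj); lia.
Qed.

(** * Two-sided second-order linear recurrences *)

Section LinearRecurrence.
Variable a : int -> int.

Fixpoint rec_pair (b : nat -> int) (x0 x1 : int) (n : nat) : int * int :=
  if n is n'.+1 then
    let p := rec_pair b x0 x1 n' in (p.2, b n' * p.2 - p.1)
  else (x0, x1).

Lemma two_sided_recurrence (x0 x1 : int) :
  exists x : int -> int, [/\ x 0 = x0, x 1 = x1
    & forall j : int, x (j + 1) + x (j - 1) = a j * x j].
Proof.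
pose F := rec_pair (fun n => a (n.+1)%:Z) x0 x1.
pose G := rec_pair (fun n => a (- n%:Z)) x1 x0.
(* [G] runs backwards from index 1, so its [k]-th entry is the value at [1 - k]; [Negz n] is
   [- (n + 1)], hence the shift by 2. *)
exists (fun j => match j with Posz n => (F n).1 | Negz n => (G n.+2).1 end).
split=> // -[[|n]|n].
- rewrite (_ : 0%:Z + 1 = 1%N) // (_ : 0%:Z - 1 = Negz 0) //=.
  by rewrite oppr0; ring.
- rewrite (_ : n.+1%:Z + 1 = n.+2); last lia.
  by rewrite (_ : n.+1%:Z - 1 = n) /=; [ring | lia].
- rewrite (_ : Negz n - 1 = Negz n.+1); last lia.
  case: n => [|n].
    rewrite (_ : Negz 0 + 1 = 0%N) //=.
    by rewrite (_ : - 1%:Z = Negz 0) //=; ring.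
  rewrite (_ : Negz n.+1 + 1 = Negz n); last lia.
  by rewrite /= -NegzE; ring.
Qed.

Lemma recurrence_wronskian (x y : int -> int) :
  (forall j : int, x (j + 1) + x (j - 1) = a j * x j) ->
  (forall j : int, y (j + 1) + y (j - 1) = a j * y j) ->
  forall j, x j * y (j + 1) - x (j + 1) * y j = x 0 * y 1 - x 1 * y 0.
Proof.
move=> xE yE.
have step j : x j * y (j + 1) - x (j + 1) * y j =
              x (j - 1) * y j - x j * y (j - 1).
  have -> : x (j + 1) = a j * x j - x (j - 1) by rewrite -xE; ring.
  have -> : y (j + 1) = a j * y j - y (j - 1) by rewrite -yE; ring.
  ring.
elim/int_rect => [//|n IH|n IH].
- rewrite step -IH (_ : n.+1%:Z - 1 = n%:Z) 1?(_ : n.+1%:Z = n%:Z + 1) //; lia.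
- rewrite -IH [RHS]step (_ : - n.+1%:Z = - n%:Z - 1); last lia.
  by rewrite subrK.
Qed.

End LinearRecurrence.

(** * Triangulations as relations on the integers *)

Section Triangulation.
Variables (E : int -> int -> bool) (N : int -> nat).
Hypothesis E_lt : forall i j, E i j -> i < j.
Hypothesis E_edge : forall i, E i (i + 1).
Hypothesis E_nc : forall i j k l, E i j -> E k l -> i < k -> k < j -> j < l -> False.
Hypothesis E_max : forall i j : int, i < j ->
  (forall k l, E k l -> i < k -> k < j -> j < l -> False) ->
  (forall k l, E k l -> k < i -> i < l -> l < j -> False) -> E i j.
Hypothesis N_out : forall i j, E i j -> j < i + (N i)%:Z.
Hypothesis N_in : forall i j, E j i -> i - (N i)%:Z < j.

(** Take for [k] the last neighbour of [m] before [n]. An arc crossing [(k, n)] would cross [(m, n)]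
    or [(m, k)], or start at [m] and contradict the choice of [k]. *)
Lemma triangle_apex (m n : int) : E m n -> m + 1 < n ->
  exists k, [/\ m < k < n, E m k, E k n,
    forall j, k < j < n -> ~~ E m j & forall j, m < j < k -> ~~ E j n].
Proof.
move=> Emn mn.
have [|j /andP[]|k /andP[Emk kn] kmax] :=
  @max_int_le (fun k => E m k && (k < n)) (m + 1) n.
- by rewrite E_edge.
- lia.
have mk := E_lt Emk.
exists k; split=> //; first by rewrite mk.
- apply: E_max => // p q Epq.
  + by move=> kp pn nq; apply: (E_nc Emn Epq) => //; lia.
  + move=> pk kq qn.
    case: (ltgtP m p) => [mp|pm|mp]; first exact: (E_nc Emk Epq).
    * by apply: (E_nc Epq Emn) => //; lia.
    * by have := kmax q; rewrite mp Epq qn; lia.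
- move=> j /andP[kj jn]; apply/negP => Emj.
  by have := kmax j; rewrite Emj jn; lia.
- by move=> j /andP[mj jk]; apply/negP => Ejn; exact: (E_nc Emk Ejn).
Qed.

Lemma max_out (i : int) : exists2 j, E i j & forall l, E i l -> l <= j.
Proof.
by apply: (@max_int_le (E i) (i + 1) (i + (N i)%:Z)) => // j /N_out/ltW.
Qed.

(** Otherwise let [n] be the last neighbour of [k] and [l] that of [n]. No arc passes over [n]
    either, so [(k, l)] crosses nothing and belongs to [E], although [l] lies beyond [n]. *)
Lemma vertex_covered (k : int) : exists m n, [/\ E m n, m < k & k < n].
Proof.
apply: contrapT => H.
have nok m n : E m n -> m < k -> k < n -> False by move=> *; apply: H; exists m, n.
have [n Ekn nmax] := max_out k.
have kn := E_lt Ekn.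
have non p q : E p q -> p < n -> n < q -> False.
  move=> Epq pn nq; case: (ltgtP p k) => [pk|kp|pk].
  - by apply: (nok _ _ Epq) => //; lia.
  - exact: (E_nc Ekn Epq).
  - by move: Epq; rewrite pk => /nmax; lia.
have [l Enl lmax] := max_out n.
have nl := E_lt Enl.
have /nmax : E k l; last lia.
apply: E_max => [|p q Epq kp pl lq|p q Epq pk kq ql]; first lia.
- case: (ltgtP p n) => [pn|np|pn].
  + by apply: (non _ _ Epq) => //; lia.
  + exact: (E_nc Enl Epq).
  + by move: Epq; rewrite pn => /lmax; lia.
- exact: nok Epq pk kq.
Qed.

Lemma interval_covered (i : int) (d : nat) :
  exists m n, [/\ E m n, m <= i & i + d%:Z <= n].
Proof.
elim: d => [|d [m [n [Emn mi idn]]]].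
  by exists i, (i + 1); split; [exact: E_edge | lia | lia].
case: (ltrP (i + d%:Z) n) => [lt|ge]; first by exists m, n; split=> //; lia.
have [p [q [Epq pn nq]]] := vertex_covered n.
exists p, q; split=> //; last lia.
(* An arc over [n] that started to the right of [m] would cross [(m, n)]. *)
by case: (lerP p m) => [|mp]; [lia | case: (E_nc Emn Epq)].
Qed.

(** The range excludes [D]: when [D] is the length of an arc from [i], that arc is left out, and the
    count is the number of triangles at [i] below it. *)
Definition out_count (i : int) (D : nat) : nat :=
  (\sum_(0 <= d < D) E i (i + d%:Z))%N.
Definition in_count (i : int) (D : nat) : nat :=
  (\sum_(0 <= d < D) E (i - d%:Z) i)%N.

(* Arcs and edges at [k], minus one: the number of triangles at [k]. *)
Definition quiddity (k : int) : int :=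
  (out_count k (N k))%:Z + (in_count k (N k))%:Z - 1.

Lemma out_countS (m k : int) (D : nat) : E m k -> k < m + D%:Z ->
  (forall j, k < j < m + D%:Z -> ~~ E m j) ->
  out_count m D = (out_count m `|k - m| + 1)%N.
Proof.
move=> Emk kD noE; have mk := E_lt Emk.
apply: (@sum_bool_last (fun d => E m (m + d%:Z))) => [||e eD]; first lia.
- by rewrite (_ : m + _ = k) //; lia.
- by apply: noE; lia.
Qed.

Lemma in_countS (k n : int) (D : nat) : E k n -> n - D%:Z < k ->
  (forall j, n - D%:Z < j < k -> ~~ E j n) ->
  in_count n D = (in_count n `|n - k| + 1)%N.
Proof.
move=> Ekn kD noE; have kn := E_lt Ekn.
apply: (@sum_bool_last (fun d => E (n - d%:Z) n)) => [||e eD]; first lia.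
- by rewrite (_ : n - _ = k) //; lia.
- by apply: noE; lia.
Qed.

(** No arc at [k] leaves the interval from [m] to [n], so the triangles at [k] lie below [(k, n)] or
    [(m, k)], except for [(m, k, n)] itself. *)
Lemma quiddity_apex (m k n : int) : E m n -> E m k -> E k n ->
  quiddity k = (out_count k `|n - k|)%:Z + (in_count k `|k - m|)%:Z + 1.
Proof.
move=> Emn Emk Ekn; have mk := E_lt Emk; have kn := E_lt Ekn.
have outE : out_count k (N k) = (out_count k `|n - k| + 1)%N.
  apply: out_countS (N_out Ekn) _ => // j /andP[nj _]; apply/negP => Ekj.
  exact: (E_nc Emn Ekj).
have inE : in_count k (N k) = (in_count k `|k - m| + 1)%N.
  apply: in_countS (N_in Emk) _ => // j /andP[_ jm]; apply/negP => Ejk.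
  exact: (E_nc Ejk Emn).
rewrite /quiddity outE inE !PoszD; ring.
Qed.

(** Induction on length: the apex of the triangle below an arc yields two shorter ones. *)
Lemma arc_ind (P : int -> int -> Prop) :
  (forall m, P m (m + 1)) ->
  (forall m k n, E m n -> E m k -> E k n -> m < k < n ->
    (forall j, k < j < n -> ~~ E m j) -> (forall j, m < j < k -> ~~ E j n) ->
    P m k -> P k n -> P m n) ->
  forall m n, E m n -> P m n.
Proof.
move=> P1 PS m n; have [D] := ubnP `|n - m|%N.
elim: D m n => // D IH m n lD Emn; have mn := E_lt Emn.
case: (ltrP (m + 1) n) => [lt|ge]; last by rewrite (_ : n = m + 1) //; lia.
have [k [mkn Emk Ekn no1 no2]] := triangle_apex Emn lt.
by apply: (PS m k n) => //; apply: IH => //; lia.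
Qed.

(** * Solutions of the quiddity recurrence along arcs *)

Section Solution.
Variable x : int -> int.
Hypothesis xE : forall j : int, x (j + 1) + x (j - 1) = quiddity j * x j.

(** Both formulas are proved together because gluing at [k] uses the first for [(k, n)] and the
    second for [(m, k)]. *)
Lemma arc_ends (m n : int) : E m n ->
  x n = x (m + 1) - (out_count m `|n - m|)%:Z * x m /\
  x m = x (n - 1) - (in_count n `|n - m|)%:Z * x n.
Proof.
move=> Emn; elim/arc_ind: m n / Emn => [m|].
  rewrite (_ : `|(m + 1 - m)%R|%N = 1%N); last lia.
  rewrite /out_count /in_count !big_nat1 subr0 !addr0 addrK.
  have /negbTE -> : ~~ E m m by apply/negP => /E_lt; rewrite ltxx.
  have /negbTE -> : ~~ E (m + 1) (m + 1) by apply/negP => /E_lt; rewrite ltxx.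
  by rewrite !mul0r !subr0.
move=> m k n Emn Emk Ekn /andP[mk kn] no1 no2 [xk1 xm] [xn xk2].
have := xE k; rewrite (quiddity_apex Emn Emk Ekn) => xkE.
have -> : out_count m `|n - m| = (out_count m `|k - m| + 1)%N.
  by apply: (out_countS Emk) => [|j jn]; [lia | apply: no1; lia].
have -> : in_count n `|n - m| = (in_count n `|n - k| + 1)%N.
  by apply: (in_countS Ekn) => [|j jn]; [lia | apply: no2; lia].
rewrite !PoszD; split.
(* Adding [xn] and [xm] and using the recurrence at [k] gives [x k = x m + x n]. *)
- transitivity (x k - x m); last by rewrite xk1; ring.
  by rewrite xn xm; move: xkE; lra.
- transitivity (x k - x n); last by rewrite xk2; ring.
  by rewrite xn xm; move: xkE; lra.
Qed.

End Solution.

(** * Determinants of two solutions *)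

Section Det.
Variables x y : int -> int.
Hypothesis xE : forall j : int, x (j + 1) + x (j - 1) = quiddity j * x j.
Hypothesis yE : forall j : int, y (j + 1) + y (j - 1) = quiddity j * y j.
Hypothesis wronskian1 : forall j, x j * y (j + 1) - x (j + 1) * y j = 1.

Definition det (i j : int) : int := x i * y j - x j * y i.

Lemma det_arc (m n : int) : E m n -> det m n = 1.
Proof.
move=> Emn; rewrite /det (arc_ends xE Emn).1 (arc_ends yE Emn).1.
by rewrite -[RHS](wronskian1 m); ring.
Qed.

Lemma det_diag (i : int) : det i i = 0.
Proof. by rewrite /det; ring. Qed.

Lemma det_tiling (i j : int) :
  det i j * det (i + 1) (j + 1) - det i (j + 1) * det (i + 1) j = 1.
Proof.
transitivity (det i (i + 1) * det j (j + 1)); first by rewrite /det; ring.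
by rewrite /det !wronskian1 mulr1.
Qed.

(* Expand [v i] in the basis [v m, v k] and [v j] in the basis [v k, v n]. *)
Lemma det_across (m k n i j : int) : E m n -> E m k -> E k n ->
  det i j = det i k * det j n + det i k * det k j + det m i * det k j.
Proof.
move=> Emn Emk Ekn.
have dmn := det_arc Emn; have dmk := det_arc Emk; have dkn := det_arc Ekn.
(* Inserting determinants equal to 1 makes the identity homogeneous, hence polynomial in the
   coordinates. *)
transitivity (det i k * det j n * det m k + det i k * det k j * det m n
              + det m i * det k j * det k n); last by rewrite dmn dmk dkn; ring.
transitivity (det i j * det m k * det k n); first by rewrite dmk dkn !mulr1.
by rewrite /det; ring.
Qed.

Lemma det_gt0_below (m n : int) : E m n ->
  forall i j, m <= i -> i < j -> j <= n -> 0 < det i j.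
Proof.
move=> Emn; elim/arc_ind: m n / Emn => [m|m k n Emn Emk Ekn _ _ _ IH1 IH2] i j mi ij jn.
  have -> : i = m by lia.
  have -> : j = m + 1 by lia.
  by rewrite (det_arc (E_edge m)).
case: (lerP j k) => [jk|kj]; first exact: IH1.
case: (lerP k i) => [ki|ik]; first exact: IH2.
(* The middle term is positive; the outer ones are nonnegative and vanish at [j = n] and [i = m]
   respectively. *)
rewrite (@det_across m k n i j) //.
have dik : 0 < det i k by exact: IH1.
have dkj : 0 < det k j by exact: IH2.
have djn : 0 <= det j n.
  case: (ltgtP j n) => [lt| |->]; [|lia|by rewrite det_diag].
  by apply/ltW/IH2 => //; lia.
have dmi : 0 <= det m i.
  case: (ltgtP m i) => [lt| |->]; [|lia|by rewrite det_diag].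
  by apply/ltW/IH1 => //; lia.
by rewrite ltr_wpDr ?mulr_ge0 ?ltr_wpDl ?mulr_gt0 ?mulr_ge0 // ltW.
Qed.

Lemma det_gt0 (i j : int) : i < j -> 0 < det i j.
Proof.
move=> ij; have [m [n [Emn mi idn]]] := interval_covered i `|j - i|.
by apply: (det_gt0_below Emn) => //; lia.
Qed.

End Det.
End Triangulation.

(** * From collections of arcs to triangulations *)

Lemma crosses_sym (a b : Qarc) : crosses a b = crosses b a.
Proof. by rewrite /crosses orbC. Qed.

Lemma maximal_mem (T : set Qarc) (a : Qarc) : maximal_non_crossing T ->
  (forall b, T b -> ~~ crosses a b) -> T a.
Proof.
move=> [Tnc Tmax] aT; rewrite -(Tmax (T `|` [set a])); first by right.
- move=> b c [Tb|->] [Tc|->]; first exact: Tnc.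
  + by rewrite crosses_sym; exact: aT.
  + exact: aT.
  + by rewrite /crosses; lia.
- by move=> b; left.
Qed.

Lemma finite_set_int_bound (A : Type) (S : set A) (f : A -> int) :
  finite_set S -> exists M : nat, forall s, S s -> (`|f s| <= M)%N.
Proof.
move=> /(finite_image f) /finite_seqP[s fS].
exists (\max_(z <- s) `|z|)%N => a Sa.
apply: (@leq_bigmax_seq _ s xpredT (fun z : int => `|z|%N)) => //.
suff : [set` s] (f a) by [].
by rewrite -fS; exists a.
Qed.

(** The edges lie outside [Qarc] but are needed as sides of triangles; a boolean value lets
    neighbours be counted by sums. *)
Definition edge_or_arc (T : set Qarc) (i j : int) : bool :=
  (j == i + 1) || `[< exists2 t, T t & val t = (i, j) >].

Lemma edge_or_arcP (T : set Qarc) (i j : int) :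
  edge_or_arc T i j ->
  j = i + 1 \/ exists t, [/\ T t, src t = i, tgt t = j & i <= j - 2].
Proof.
case/orP => [/eqP|/asboolP [t Tt tE]]; first by left.
by right; exists t; rewrite /src /tgt tE; split=> //; have := valP t; rewrite tE.
Qed.

Section EdgeOrArc.
Variable T : set Qarc.
Hypothesis T_max : maximal_non_crossing T.
Let E := edge_or_arc T.

Lemma edge_or_arc_lt i j : E i j -> i < j.
Proof. by move/edge_or_arcP => [|[t [_ _ _]]]; lia. Qed.

Lemma edge_or_arc_edge i : E i (i + 1).
Proof. by rewrite /E /edge_or_arc eqxx. Qed.

Lemma edge_or_arc_mem t : T t -> E (src t) (tgt t).
Proof.
by move=> Tt; apply/orP; right; apply/asboolP; exists t; case: t Tt => -[].
Qed.

Lemma edge_or_arc_nc i j k l :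
  E i j -> E k l -> i < k -> k < j -> j < l -> False.
Proof.
move=> /edge_or_arcP[->|[t [Tt ti tj _]]] /edge_or_arcP[->|[u [Tu uk ul _]]];
  try lia.
by move=> ik kj jl; have := T_max.1 _ _ Tt Tu; rewrite /crosses ti tj uk ul; lia.
Qed.

Lemma edge_or_arc_max i j : i < j ->
  (forall k l, E k l -> i < k -> k < j -> j < l -> False) ->
  (forall k l, E k l -> k < i -> i < l -> l < j -> False) -> E i j.
Proof.
move=> ij H1 H2; case: (eqVneq j (i + 1)) => [->|ne]; first exact: edge_or_arc_edge.
have Q : (i, j).1 <= (i, j).2 - 2 :> int by move=> /=; lia.
pose a : Qarc := exist _ (i, j) Q.
apply: (@edge_or_arc_mem a); apply: maximal_mem => // b /edge_or_arc_mem Eb.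
rewrite /crosses -[src a]/i -[tgt a]/j; apply/negP => /orP[] /and3P[].
- exact: H1 Eb.
- exact: H2 Eb.
Qed.

Lemma edge_or_arc_bound : locally_finite T -> forall i, exists M : nat,
  (forall j, E i j -> j < i + M%:Z) /\ (forall j, E j i -> i - M%:Z < j).
Proof.
move=> T_lf i; have [fin_in fin_out] := T_lf i.
have [M1 HM1] := finite_set_int_bound tgt fin_out.
have [M2 HM2] := finite_set_int_bound src fin_in.
(* [M1] and [M2] bound endpoints, not lengths: the absolute value of [i] corrects for this, and 2
   covers the edges and strictness. *)
exists (M1 + M2 + `|i| + 2)%N; split=> j /edge_or_arcP[->|[t [Tt ti tj _]]].
- lia.
- by have := HM1 t (conj Tt ti); rewrite tj; lia.
- lia.
- by have := HM2 t (conj Tt tj); rewrite ti; lia.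
Qed.

End EdgeOrArc.

Unset Implicit Arguments.

Theorem theorem7p3 (T : set Qarc)
    (T_max : maximal_non_crossing T) (T_lf : locally_finite T) :
  exists r : Qarc -> int,
    [/\ SL2_tiling r,
        forall a, 0 < r a
      & forall t, T t -> r t = 1].
Proof.
have [N HN] := choice (edge_or_arc_bound T_lf).
pose E := edge_or_arc T.
have Elt := @edge_or_arc_lt T; have Eed := edge_or_arc_edge T.
have Enc := edge_or_arc_nc T_max; have Emax := edge_or_arc_max T_max.
have Nout i := (HN i).1; have Nin i := (HN i).2.
have [x [x0 x1 xE]] := two_sided_recurrence (quiddity E N) 1 0.
have [y [y0 y1 yE]] := two_sided_recurrence (quiddity E N) 0 1.
have w1 j : x j * y (j + 1) - x (j + 1) * y j = 1.
  by rewrite (recurrence_wronskian xE yE) x0 x1 y0 y1.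
have tiling := det_tiling w1.
exists (fun a => det x y (src a) (tgt a)); split.
- split=> [i j a b c d|i a b c]; rewrite /src /tgt.
  + by move=> -> -> -> -> /=; exact: tiling.
  (* The boundary relation is the general one at [j = i + 2], where the last factor is the Wronskian
     1. *)
  + move=> -> -> -> /=; have := tiling i (i + 2).
    have := w1 (i + 1); rewrite -[i + 1 + 1]addrA -[i + 2 + 1]addrA.
    by rewrite -/(det x y _ _) => ->; rewrite mulr1.
- move=> a; apply: (det_gt0 Elt Eed Enc Emax Nout Nin xE yE w1).
  by have := valP a; rewrite /src /tgt; lia.
- move=> t Tt; apply: (det_arc Elt Eed Enc Emax Nout Nin xE yE w1).
  exact: edge_or_arc_mem.
Qed.
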